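(* Let $s>0$ and $u_0\in H^s(\mathbb{R}^n)$. Then: (1) if $-\frac n2<r^{*}(u_0)<\infty$, then $-\frac n2+s<r_s^{*}(u_0)<\infty$ and $r_s^{*}(u_0)=s+r^{*}(u_0)$; (2) $r_s^{*}(u_0)=\infty$ if and only if $r^{*}(u_0)=\infty$; (3) $r^{*}(u_0)=-\frac n2$ if and only if $r_s^{*}(u_0)=r^{*}(u_0)+s=-\frac n2+s$.
   Context: For $s\ge0$, $u_0\in L^2(\mathbb{R}^n)$ and $\Lambda=(-\Delta)^{1/2}$, the decay indicator corresponding to $\Lambda^s u_0$ is, for $r\in(-\frac n2+s,\infty)$, $$P_r^s(u_0)=\lim_{\rho\to0}\rho^{-2r-n}\int_{B(\rho)}|\xi|^{2s}|\widehat{u}_0(\xi)|^2\,d\xi,$$ where $B(\rho)$ is the ball of radius $\rho$ centered at the origin. The decay character of $\Lambda^s u_0$, denoted $r_s^{*}(u_0)$, is the unique $r\in(-\frac n2+s,\infty)$ such that $0<P_r^s(u_0)<\infty$, provided this number exists; if no such $r$ exists, one sets $r_s^{*}(u_0)=-\frac n2+s$ when $P_r^s(u_0)=\infty$ for all $r\in(-\frac n2+s,\infty)$, and $r_s^{*}(u_0)=\infty$ when $P_r^s(u_0)=0$ for all $r\in(-\frac n2+s,\infty)$. For $s=0$ one writes $P_r=P_r^0$ and $r^{*}=r_0^{*}$.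
   Formalization: Item (3) is stated assuming the limit P_r^s(u_0) exists in [0,∞] for every r > -n/2+s; otherwise r* = -n/2 can hold while r_s* is undefined. The converse, r_s* = -n/2+s implies r* = -n/2, is proved without this assumption. *)

(* Defs.v *)
From HB Require Import structures.
From mathcomp Require Import all_boot all_order all_algebra.
From mathcomp Require Import complex.
From mathcomp Require Import all_classical all_reals all_analysis.
Set Implicit Arguments.
Unset Strict Implicit.
Unset Printing Implicit Defensive.
Import Order.TTheory GRing.Theory Num.Theory.
Import numFieldNormedType.Exports.
Local Open Scope classical_set_scope.
Local Open Scope ring_scope.

Section lebesgue_tuple.
Context {R : realType}.

Definition tuple_cons n (x : R * n.-tuple R) : n.+1.-tuple R :=
  [tuple of x.1 :: x.2].

Lemma measurable_tuple_cons n : measurable_fun [set: R * n.-tuple R] (@tuple_cons n).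
Proof. exact: (measurable_cons measurable_fst measurable_snd). Qed.

Definition lebesgue_cons n (m : {sigma_finite_measure set (n.-tuple R) -> \bar R})
    : set (n.+1.-tuple R) -> \bar R :=
  pushforward ((@lebesgue_measure R) \x m)%E (@tuple_cons n).

Section instances.
Variables (n : nat) (m : {sigma_finite_measure set (n.-tuple R) -> \bar R}).

Let lebesgue_cons0 : lebesgue_cons m set0 = 0%E.
Proof. by rewrite /lebesgue_cons /pushforward preimage_set0 measure0. Qed.

Let lebesgue_cons_ge0 A : (0 <= lebesgue_cons m A)%E.
Proof. by rewrite /lebesgue_cons /pushforward. Qed.

Let lebesgue_cons_sigma_additive : semi_sigma_additive (lebesgue_cons m).
Proof.
move=> F mF tF mUF; rewrite /lebesgue_cons /pushforward preimage_bigcup.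
apply: measure_semi_sigma_additive.
- by move=> k; rewrite -[X in measurable X]setTI; exact: measurable_tuple_cons.
- apply/trivIsetP => /= i j _ _ ij; rewrite -preimage_setI.
  by move/trivIsetP : tF => /(_ _ _ _ _ ij) ->//; rewrite preimage_set0.
- by rewrite -preimage_bigcup -[X in measurable X]setTI; exact: measurable_tuple_cons.
Qed.

HB.instance Definition _ := isMeasure.Build _ _ _ (lebesgue_cons m)
  lebesgue_cons0 lebesgue_cons_ge0 lebesgue_cons_sigma_additive.

Let lebesgue_cons_sigma_finite : sigma_finite setT (lebesgue_cons m).
Proof.
have /sigma_finiteP[F [TF ndF Foo]] := sigma_finiteT (@lebesgue_measure R).
have /sigma_finiteP[G [TG ndG Goo]] := sigma_finiteT m.
pose g (y : n.+1.-tuple R) : R * n.-tuple R := (thead y, [tuple of behead y]).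
have mg : measurable_fun setT g.
  apply/measurable_fun_pair; first exact: measurable_tnth.
  exact: measurable_behead.
have gK x : g (tuple_cons x) = x.
  by case: x => a t; congr pair; apply/val_inj.
exists (fun k => g @^-1` (F k `*` G k)).
  rewrite predeqE => y; split=> // _; rewrite /bigcup/=.
  have [k _ Fk] : (\bigcup_k F k) (g y).1 by rewrite -TF.
  have [l _ Gl] : (\bigcup_k G k) (g y).2 by rewrite -TG.
  exists (maxn k l) => //; split.
  - by move: Fk; exact/subsetPset/ndF/leq_maxl.
  - by move: Gl; exact/subsetPset/ndG/leq_maxr.
move=> k; have [mF ?] := Foo k; have [mG ?] := Goo k; split.
  by rewrite -[X in measurable X]setTI; apply: mg => //; exact: measurableX.
rewrite /lebesgue_cons /pushforward (_ : _ @^-1` _ = F k `*` G k).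
  by rewrite product_measure1E// lte_mul_pinfty// ge0_fin_numE.
by apply/funext => x; exact: (congr1 (F k `*` G k) (gK x)).
Qed.

HB.instance Definition _ := Measure_isSigmaFinite.Build _ _ _ (lebesgue_cons m)
  lebesgue_cons_sigma_finite.

End instances.

(* R^n is represented by n.-tuple R with its product sigma-algebra, and its
   Lebesgue measure is the n-fold product of the Lebesgue measure on R. *)
Fixpoint lebesgue_tuple n : {sigma_finite_measure set (n.-tuple R) -> \bar R} :=
  match n with
  | 0%N => dirac ([tuple] : 0.-tuple R)
  | n'.+1 => lebesgue_cons (lebesgue_tuple n')
  end.

End lebesgue_tuple.

Section fourier.
Context {R : realType}.
Local Notation cnorm := (@ComplexField.Normc.normc R).
Local Notation Re := (@complex.Re R).
Local Notation Im := (@complex.Im R).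

Definition dotprod n (x y : n.-tuple R) : R := \sum_(i < n) tnth x i * tnth y i.

Definition enorm n (x : n.-tuple R) : R := Num.sqrt (dotprod x x).

Definition eball n (rho : R) : set (n.-tuple R) := [set x | enorm x < rho].

Definition cis (t : R) : R[i] := Complex (cos t) (sin t).

Definition cintegral n (D : set (n.-tuple R)) (f : n.-tuple R -> R[i]) : R[i] :=
  Complex (Rintegral (lebesgue_tuple n) D (Re \o f))
          (Rintegral (lebesgue_tuple n) D (Im \o f)).

Definition L2norm n (u : n.-tuple R -> R[i]) : \bar R :=
  Lnorm (lebesgue_tuple n) 2%:E (fun x => (cnorm (u x))%:E).

Definition L2 n (u : n.-tuple R -> R[i]) : Prop :=
  [/\ measurable_fun setT (Re \o u), measurable_fun setT (Im \o u)
    & (L2norm u < +oo)%E].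

Definition truncated_fourier n (k : nat) (u : n.-tuple R -> R[i])
    (xi : n.-tuple R) : R[i] :=
  cintegral (eball k%:R) (fun x => cis (- dotprod x xi) * u x).

(* The Fourier-Plancherel transform on L^2(R^n), with the convention
   \hat u(xi) = \int e^{-i x.xi} u(x) dx: u itself need not be integrable, so
   \hat u is the L^2-limit of the transforms of u restricted to balls. *)
Definition is_fourier n (u v : n.-tuple R -> R[i]) : Prop :=
  L2 v /\
  (fun k => L2norm (fun xi => v xi - truncated_fourier k u xi)) @ \oo --> 0%E.

(* By Plancherel's theorem the default value 0 is never used for u in L^2;
   \hat u is determined up to a null set. *)
Definition fourier n (u : n.-tuple R -> R[i]) : n.-tuple R -> R[i] :=
  xget (fun=> 0) [set v | is_fourier u v].

Definition sobolev n (s : R) (u : n.-tuple R -> R[i]) : Prop :=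
  L2 u /\
  L2 (fun xi => Complex ((1 + enorm xi ^+ 2) `^ (s / 2)) 0 * fourier u xi).

End fourier.

Section decay_character.
Context {R : realType}.
Local Notation cnorm := (@ComplexField.Normc.normc R).
Variables (n : nat) (s : R) (u0 : n.-tuple R -> R[i]).

Definition decay_quotient (r rho : R) : \bar R :=
  ((rho `^ (- (2 * r) - n%:R))%:E *
   \int[lebesgue_tuple n]_(xi in eball rho)
     (enorm xi `^ (2 * s) * cnorm (fourier u0 xi) ^+ 2)%:E)%E.

Definition decay_indicator (r : R) : \bar R :=
  lim (decay_quotient r rho @[rho --> 0^'+]).

(* The limit may fail to exist in the extended reals, and [decay_indicator r]
   is then meaningless. Existence at order 0 does not imply existence at order
   s > 0: let the mass F(rho) of |\hat u0|^2 on the ball of radius rho decrease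
   to 0 through the values 1/k, all the variation taking place close to the
   radii exp(-2^k). Then rho^{-2r-n} F(rho) tends to +oo for all r > -n/2, while
   the quotient of order s > 0 oscillates for r close to -n/2 + s. *)
Definition decay_indicator_exists (r : R) : Prop :=
  cvg (decay_quotient r rho @[rho --> 0^'+]).

Definition decay_index_min : R := - (n%:R / 2) + s.

Definition is_decay_character (rstar : \bar R) : Prop :=
  [\/ exists r : R, [/\ rstar = r%:E, decay_index_min < r,
        decay_indicator_exists r & (0 < decay_indicator r < +oo)%E],
      rstar = decay_index_min%:E /\
        (forall r, decay_index_min < r ->
           decay_indicator_exists r /\ decay_indicator r = +oo%E)
    | rstar = +oo%E /\
        (forall r, decay_index_min < r ->
           decay_indicator_exists r /\ decay_indicator r = 0%E)].

(* At most one value satisfies [is_decay_character], but there may be none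
   (e.g. when the indicators do not exist). The value -oo, which is smaller
   than every genuine decay character, stands for "undefined". *)
Definition decay_character : \bar R := xget -oo%E [set r | is_decay_character r].

End decay_character.

(* Main.v *)
Require Import Defs.
From mathcomp Require Import all_boot all_order all_algebra.
From mathcomp Require Import complex.
From mathcomp Require Import all_classical all_reals all_analysis.
From mathcomp Require Import measurable_realfun.
From mathcomp Require Import ring lra.
Set Implicit Arguments.
Unset Strict Implicit.
Unset Printing Implicit Defensive.
Import Order.TTheory GRing.Theory Num.Theory.
Import numFieldNormedType.Exports.
Local Open Scope classical_set_scope.
Local Open Scope ring_scope.

(** Put F(x) = int_{|xi| < x} |v|^2 and G(x) = int_{|xi| < x} |xi|^b |v|^2,
    where v is the Fourier transform of u0 and b = 2s. With p = 2r + n, the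
    decay quotient of order 0 at r is x^-p F(x), the one of order s at r + s is
    x^-(p + b) G(x), and r > - n/2 means p > 0. So everything is a comparison of
    the behaviours of F and G at 0, and all that matters about F and G is the
    shell inequality

      x^b (F y - F x) <= G y - G x <= y^b (F y - F x)      (0 < x <= y),

    which holds because |xi|^b lies between x^b and y^b on the shell
    x <= |xi| < y, together with F, G -> 0 at 0. The latter is where n > 0 is
    used: the origin is a Lebesgue-null set.

    The tool that turns shell estimates into estimates of F and G themselves is
    [telescope_at_right0]: if H -> 0 at 0 and H x - H (t x) <= A (x^q - (t x)^q)
    for one ratio 0 < t < 1 and all small x, then H x <= A x^q for these x, by
    summing over the shells between t^(k+1) x and t^k x.

    - The trivial bound G <= x^b F makes the weighted quotient at most the
      unweighted one; telescoping F with ratio 1/2 gives the converse up to a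
      constant ([near_quotient_le_of_weighted]). Hence one quotient tends to 0
      if and only if the other does; the weighted one tends to +oo only if the
      unweighted one does; and if the unweighted one tends to +oo, then the
      weighted one is unbounded, so it tends to +oo as soon as it has a limit.
    - If x^-p F(x) -> P > 0, then x^-(p + b) G(x) -> P p / (p + b), as it does
      for F = P x^p by integration. Telescoping with a ratio t close to 1 gives
      this up to a factor t^b on either side ([quotient_cvg_weighted]).

    The four claims follow by inspecting the three cases of the definition of
    the decay character, which determines its value uniquely. Finiteness of F
    and G is read off membership in H^s: the weight (1 + |xi|^2)^(s/2) is at
    least 1, so |v|^2 is integrable, and |xi|^b is bounded on balls. *)

(** * Real powers *)

Lemma cvg_powR_at_right0 (R : realType) (q : R) : 0 < q ->
  t `^ q @[t --> 0^'+] --> (0 : R).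
Proof.
move=> q0; apply/cvgrPdist_lt => e e0; near=> t.
have t0 : 0 < t by near: t; exact: nbhs_right_gt.
rewrite sub0r normrN ger0_norm ?powR_ge0//.
have te : t < e `^ q^-1.
  by near: t; apply: nbhs_right_lt; rewrite powR_gt0.
have := gt0_ltr_powR q0 _ _ te; rewrite !nnegrE (ltW t0) powR_ge0.
by rewrite -powRrM mulVf ?gt_eqF// powRr1 ?ltW//; apply.
Unshelve. all: by end_near. Qed.

Lemma powR_lt1 (R : realType) (x q : R) : 0 <= x < 1 -> 0 < q -> x `^ q < 1.
Proof.
move=> /andP[x0 x1] q0.
by have := gt0_ltr_powR q0 x0 (ler01 : 1 \in Num.nneg) x1; rewrite powR1.
Qed.

(** Young's inequality x * 1 <= x^a / a + 1 / a', multiplied by a. *)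
Lemma bernoulli_powR (R : realType) (a x : R) : 1 <= a -> 0 <= x ->
  a * (x - 1) <= x `^ a - 1.
Proof.
rewrite le_eqVlt => /predU1P[<- x0|a1 x0]; first by rewrite mul1r powRr1.
have a0 : 0 < a by exact: lt_trans a1.
have b0 : 0 < a / (a - 1) by rewrite divr_gt0// subr_gt0.
have := @conjugate_powR R x 1 a _ x0 ler01 a0 b0.
rewrite powR1 mulr1 div1r invf_div => /(_ _).
have -> : a^-1 + (a - 1) / a = 1 by field; rewrite gt_eqF.
move=> /(_ erefl); rewrite -(ler_pM2l a0).
have -> : a * (x `^ a / a + (a - 1) / a) = x `^ a + (a - 1).
  by field; rewrite gt_eqF.
lra.
Qed.

(** Bernoulli's inequality at t^p with exponent q / p; the next lemma is this
    one at t^-1. Together they are the shell inequality for F = x^p,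
    G = p / q * x^q and b = q - p, on the shell between t and 1. *)
Lemma powR_slope_ge (R : realType) (p q t : R) : 0 < p -> p <= q -> 0 <= t ->
  p / q * (1 - t `^ q) <= 1 - t `^ p.
Proof.
move=> p0 pq t0; have q0 : 0 < q by exact: lt_le_trans pq.
have qp1 : 1 <= q / p by rewrite ler_pdivlMr ?mul1r.
have := bernoulli_powR qp1 (powR_ge0 t p).
rewrite -powRrM mulrCA mulfV ?gt_eqF// mulr1 => h.
have := ler_wpM2l (ltW (divr_gt0 p0 q0)) h.
rewrite mulrA (_ : p / q * (q / p) = 1); last by field; rewrite !gt_eqF.
lra.
Qed.

Lemma powR_slope_le (R : realType) (p q t : R) : 0 < p -> p <= q -> 0 < t ->
  t `^ (q - p) * (1 - t `^ p) <= p / q * (1 - t `^ q).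
Proof.
move=> p0 pq t0; have := powR_slope_ge p0 pq (ltW (divr_gt0 ltr01 t0)).
rewrite div1r.
have E u : (t^-1) `^ u = (t `^ u)^-1.
  by rewrite -powR_inv1 ?ltW// -powRrM mulN1r powRN.
rewrite !E => h.
have tq0 : 0 < t `^ q by exact: powR_gt0.
have tp0 : 0 < t `^ p by exact: powR_gt0.
have -> : t `^ (q - p) = t `^ q / t `^ p.
  by rewrite powRD ?powRN// (gt_eqF t0) implybT.
have := ler_wpM2l (ltW tq0) h.
have -> : t `^ q * (p / q * (1 - (t `^ q)^-1)) = p / q * (t `^ q - 1).
  by field; rewrite !gt_eqF// (lt_le_trans p0).
have -> : t `^ q * (1 - (t `^ p)^-1) = - (t `^ q / t `^ p * (1 - t `^ p)).
  by field; rewrite gt_eqF.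
lra.
Qed.

(** * Transfer between a function and its weighted version *)

(** By the hypothesis H x - A x^q does not decrease when x is replaced by t x,
    and it tends to 0 along the sequence t^k x. *)
Lemma telescope_at_right0 (R : realType) (H : R -> R) (A q t d : R) :
  0 < q -> 0 < t < 1 -> H x @[x --> 0^'+] --> (0 : R) ->
  (forall x, 0 < x < d -> H x - H (t * x) <= A * (x `^ q - (t * x) `^ q)) ->
  forall x, 0 < x < d -> H x <= A * x `^ q.
Proof.
move=> q0 /andP[t0 t1] H0 step x /andP[x0 xd].
pose phi y := H y - A * y `^ q.
have phi0 : phi y @[y --> 0^'+] --> (0 : R).
  rewrite -[X in _ --> X](subrr (0 : R)); apply: cvgB => //.
  rewrite -[X in _ --> X](mulr0 A).
  exact: (cvgM (cvg_cst A) (cvg_powR_at_right0 q0)).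
have xk0 k : 0 < t ^+ k * x by rewrite mulr_gt0// exprn_gt0.
have phik k : phi x <= phi (t ^+ k * x).
  elim: k => [|k /le_trans]; first by rewrite expr0 mul1r.
  apply; rewrite /phi exprS -mulrA.
  have := step (t ^+ k * x); rewrite xk0 (le_lt_trans _ xd) => [/(_ isT)|].
    lra.
  by rewrite ler_piMl ?(ltW x0)// exprn_ile1// ltW.
have xk : (t ^+ k * x) @[k --> \oo] --> (0 : R).
  under eq_fun do rewrite mulrC.
  by apply: (@cvg_geometric _ x t); rewrite gtr0_norm.
have phixk : phi (t ^+ k * x) @[k --> \oo] --> (0 : R).
  by move/cvg_at_rightP : phi0; apply; split.
rewrite -subr_le0 -[X in _ <= X](cvg_lim _ phixk)//.
by apply: limr_ge; [exact: cvgP phixk|exact: nearW].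
Qed.

(** What remains of dG = x^b dF when only increments are available. *)
Definition shell_comparable (R : realType) (b : R) (F G : R -> R) :=
  forall x y, 0 < x -> x <= y ->
    x `^ b * (F y - F x) <= G y - G x <= y `^ b * (F y - F x).

Section tauberian.
Context {R : realType}.
Variables (b p : R) (F G : R -> R).
Hypotheses (b_gt0 : 0 < b) (p_gt0 : 0 < p).
Hypothesis (FG : shell_comparable b F G).
Hypothesis (F0 : F x @[x --> 0^'+] --> (0 : R)).
Hypothesis (G0 : G x @[x --> 0^'+] --> (0 : R)).

(** On the shell between x / 2 and x the increment of F is at most (x / 2)^-b
    times that of G, hence at most 2^b C x^p, which is a multiple of the
    increment of x^p. *)
Lemma quotient_bound_of_weighted (C d : R) :
  (forall x, 0 < x -> 0 <= G x) ->
  (forall x, 0 < x < d -> G x <= C * x `^ (p + b)) ->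
  forall x, 0 < x < d -> F x <= 2 `^ b * C / (1 - 2^-1 `^ p) * x `^ p.
Proof.
move=> G_ge0 GC.
have h0 : (0 : R) < 2^-1 by rewrite invr_gt0.
have h1 : (2^-1 : R) < 1 by rewrite invf_lt1// ltr1n.
have hp : 2^-1 `^ p < 1.
  by rewrite powR_lt1// (ltW h0).
apply: (@telescope_at_right0 _ _ _ _ 2^-1) => //; first by rewrite h0 h1.
move=> x /andP[x0 xd].
have hx0 : 0 < 2^-1 * x by rewrite mulr_gt0.
have hxx : 2^-1 * x <= x by rewrite ler_piMl ?ltW.
have /andP[shell _] := FG hx0 hxx.
have Gx : G x <= C * (x `^ p * x `^ b).
  by rewrite -powRD ?(gt_eqF x0) ?implybT// GC// x0.
have := G_ge0 _ hx0.
rewrite !powRM ?(ltW x0) ?(ltW h0)// in shell *.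
have c0 : 0 < (2^-1 : R) `^ b by exact: powR_gt0.
have xb0 : 0 < x `^ b by exact: powR_gt0.
have -> : 2 `^ b = (2^-1 `^ b)^-1 :> R.
  by rewrite -[2^-1 in RHS]powR_inv1// -powRrM mulN1r powRN invrK.
move=> Ghx.
have : 2^-1 `^ b * x `^ b * (F x - F (2^-1 * x)) <= C * (x `^ p * x `^ b) by lra.
rewrite mulrAC mulrA ler_pM2r// => h.
rewrite -(ler_pM2l c0) (le_trans h)// le_eqVlt; apply/orP; left; apply/eqP.
have k0 : 1 - 2^-1 `^ p != 0 :> R by rewrite subr_eq0 gt_eqF.
by field; rewrite k0 gt_eqF.
Qed.

(** Up to an error e x^p, the increment of F between t x and x is
    P (1 - t^p) x^p. The shell inequality bounds the increment of G by x^b and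
    by t^b x^b times this, and [powR_slope_ge] and [powR_slope_le] compare the
    result with the increment L (1 - t^(p + b)) x^(p + b) of L x^(p + b), where
    L = P p / (p + b), with a loss of a factor t^b = m. It remains to take m
    close to 1, then e small depending on m. *)
Lemma quotient_cvg_weighted (P : R) : 0 < P ->
  x `^ (- p) * F x @[x --> 0^'+] --> P ->
  x `^ (- (p + b)) * G x @[x --> 0^'+] --> P * (p / (p + b)).
Proof.
move=> P0 FP; set L := P * _.
have q0 : 0 < p + b by rewrite addr_gt0.
have L0 : 0 < L by rewrite mulr_gt0// divr_gt0.
apply/cvgrPdist_le => eta eta0.
(* m is chosen so that L / m exceeds L by exactly eta / 2. *)
pose m := L / (L + eta / 2).
have m0 : 0 < m by rewrite divr_gt0// addr_gt0// divr_gt0.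
have m1 : m < 1.
  by rewrite ltr_pdivrMr ?mul1r ?ltrDl ?divr_gt0// addr_gt0// divr_gt0.
have Lm : L = m * (L + eta / 2).
  by rewrite /m mulfVK// gt_eqF// addr_gt0// divr_gt0.
pose t := m `^ b^-1.
have t0 : 0 < t by exact: powR_gt0.
have tb : t `^ b = m by rewrite -powRrM mulVf ?gt_eqF// powRr1 ?ltW.
have t_lt1 z : 0 < z -> t `^ z < 1.
  by move=> z0; rewrite -powRrM powR_lt1 ?(ltW m0)// mulr_gt0 ?invr_gt0.
have t1 : t < 1 by rewrite -[t]powRr1 ?t_lt1 ?ltW.
pose w := 1 - t `^ (p + b).
have w0 : 0 < w by rewrite subr_gt0 t_lt1.
(* The error in F enters twice, and 2 e must not exceed eta / 2 * w. *)
pose e := eta / 4 * w.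
have e0 : 0 < e by rewrite mulr_gt0 ?divr_gt0.
have /cvgrPdist_le/(_ _ e0) := FP.
move=> [d /= d0 Hd].
have FPe x : 0 < x < d -> (P - e) * x `^ p <= F x <= (P + e) * x `^ p.
  move=> /andP[x0 xd]; have := Hd x.
  rewrite /= sub0r normrN gtr0_norm// => /(_ xd x0).
  rewrite ler_norml powRN; have xp0 : 0 < x `^ p by exact: powR_gt0.
  move=> /andP[h1 h2]; apply/andP; split.
    by rewrite -ler_pdivlMr// mulrC; lra.
  by rewrite -ler_pdivrMr// mulrC; lra.
have pq : p <= p + b by rewrite lerDl ltW.
have Lw_le : L * w <= P * (1 - t `^ p).
  by rewrite /L -mulrA ler_pM2l//; exact: powR_slope_ge (ltW t0).
have Lw_ge : P * (1 - t `^ p) <= (L + eta / 2) * w.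
  have := powR_slope_le p_gt0 pq t0.
  rewrite addrC addKr tb -(ler_pM2l P0) mulrCA [leRHS]mulrA -/L {1}Lm.
  by rewrite -[leRHS]mulrA ler_pM2l.
have Lm_ge : L - eta / 2 <= m * L.
  suff : m * (eta / 2) <= eta / 2 by rewrite [X in X - _]Lm; lra.
  by rewrite ler_piMl ?ltW// divr_gt0.
have shell x : 0 < x < d -> exists2 D,
    m * (x `^ b * D) <= G x - G (t * x) <= x `^ b * D &
    x `^ p * (L * w - 2 * e) <= D <= x `^ p * ((L + eta / 2) * w + 2 * e).
  move=> /andP[x0 xd]; have tx0 : 0 < t * x by rewrite mulr_gt0.
  have txx : t * x <= x by rewrite ler_piMl ?ltW.
  exists (F x - F (t * x)).
    by have := FG tx0 txx; rewrite powRM ?(ltW t0) ?(ltW x0)// tb mulrA.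
  have /andP[l1 u1] : (P - e) * x `^ p <= F x <= (P + e) * x `^ p.
    by apply: FPe; rewrite x0.
  have := FPe (t * x); rewrite tx0 (le_lt_trans txx)// => /(_ isT).
  rewrite powRM ?(ltW t0) ?(ltW x0)// => /andP[l2 u2].
  have xp0 : 0 < x `^ p by exact: powR_gt0.
  have tp1 : t `^ p <= 1 by rewrite ltW// t_lt1.
  have h1 := ler_wpM2l (ltW xp0) Lw_le.
  have h2 := ler_wpM2l (ltW xp0) Lw_ge.
  have h3 : e * (t `^ p * x `^ p) <= e * x `^ p.
    by rewrite ler_pM2l// ler_piMl// ltW.
  by apply/andP; split; lra.
have powq x : 0 < x -> x `^ (p + b) - (t * x) `^ (p + b) = x `^ p * x `^ b * w.
  move=> x0; rewrite powRM ?(ltW t0) ?(ltW x0)// [x `^ (p + b)]powRD.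
    by rewrite /w; ring.
  by rewrite (gt_eqF x0) implybT.
(* Upper bound by telescoping G, lower bound by telescoping - G. *)
have Gup x : 0 < x < d -> G x <= (L + eta) * x `^ (p + b).
  apply: (telescope_at_right0 (t := t) (d := d) q0 _ G0) => [|{}x xd].
    by rewrite t0 t1.
  have [D /andP[_ GD] /andP[_ DL]] := shell _ xd.
  have x0 : 0 < x by case/andP: xd.
  rewrite (le_trans GD)// powq//.
  have := ler_wpM2l (powR_ge0 x b) DL.
  rewrite /e; lra.
have Glo x : 0 < x < d -> - G x <= (- L + eta) * x `^ (p + b).
  apply: (@telescope_at_right0 _ (fun y => - G y) _ _ t d q0) => [||{}x xd].
  - by rewrite t0 t1.
  - by rewrite -[X in _ --> X]oppr0; exact: cvgN.
  have [D /andP[GD _] /andP[DL _]] := shell _ xd.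
  have x0 : 0 < x by case/andP: xd.
  have xb0 : 0 < x `^ b by exact: powR_gt0.
  have xp0 : 0 < x `^ p by exact: powR_gt0.
  have h1 := ler_wpM2l (ltW (mulr_gt0 m0 xb0)) DL.
  have h2 := ler_wpM2l (ltW (mulr_gt0 (mulr_gt0 xb0 xp0) w0)) Lm_ge.
  have h3 : m * (x `^ b * x `^ p * e) <= x `^ b * x `^ p * e.
    by rewrite ler_piMl ?(ltW m1)// ltW// !mulr_gt0.
  rewrite powq//.
  rewrite /e in h1 h3; lra.
near=> x.
have x0 : 0 < x by near: x; exact: nbhs_right_gt.
have xd : 0 < x < d by rewrite x0/=; near: x; exact: nbhs_right_lt.
have xq0 : 0 < x `^ (p + b) by exact: powR_gt0.
have := Gup _ xd; have := Glo _ xd; rewrite powRN.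
have -> : G x = x `^ (p + b) * ((x `^ (p + b))^-1 * G x).
  by rewrite mulrA mulfV ?gt_eqF// mul1r.
rewrite mulKf ?gt_eqF// -mulrN ![x `^ _ * _]mulrC !ler_pM2r// ler_norml.
by move=> h1 h2; apply/andP; split; lra.
Unshelve. all: by end_near. Qed.

Hypothesis (G_le : forall x, 0 < x -> 0 <= G x <= x `^ b * F x).

Lemma weighted_quotient_le x : 0 < x ->
  0 <= x `^ (- (p + b)) * G x <= x `^ (- p) * F x.
Proof.
move=> x0; have /andP[Gx0 Gx] := G_le x0.
have xq0 : 0 <= x `^ (- (p + b)) by exact: powR_ge0.
rewrite mulr_ge0//= (le_trans (ler_wpM2l xq0 Gx))// mulrA -powRD.
  by rewrite opprD subrK.
by rewrite (gt_eqF x0) implybT.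
Qed.

Lemma near_quotient_le_of_weighted (C : R) :
  (\forall x \near 0^'+, x `^ (- (p + b)) * G x <= C) ->
  \forall x \near 0^'+,
    0 <= x `^ (- p) * F x <= 2 `^ b * C / (1 - 2^-1 `^ p).
Proof.
move=> [d /= d0 Hd]; near=> x.
have x0 : 0 < x by near: x; exact: nbhs_right_gt.
have xd : 0 < x < d by rewrite x0/=; near: x; exact: nbhs_right_lt.
have /andP[Gq Fq] := weighted_quotient_le x0; rewrite (le_trans Gq Fq)/=.
rewrite powRN mulrC ler_pdivrMr ?powR_gt0//.
apply: (@quotient_bound_of_weighted C d) => // y.
  by move=> /G_le/andP[].
move=> /andP[y0 yd]; have := Hd y.
rewrite /= sub0r normrN gtr0_norm// => /(_ yd y0).
by rewrite powRN mulrC ler_pdivrMr ?powR_gt0.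
Unshelve. all: by end_near. Qed.

Lemma quotient_cvg0_of_weighted :
  x `^ (- (p + b)) * G x @[x --> 0^'+] --> (0 : R) ->
  x `^ (- p) * F x @[x --> 0^'+] --> (0 : R).
Proof.
move=> Gq0; apply/cvgrPdist_le => e e0.
have h0 : 0 <= (2^-1 : R) < 1 by apply/andP; split; lra.
have k0 : 0 < 1 - 2^-1 `^ p :> R by rewrite subr_gt0 powR_lt1.
have c0 : 0 < (2 : R) `^ b by exact: powR_gt0.
(* C is the bound on the weighted quotient for which the other bound is e. *)
pose C := e * (1 - 2^-1 `^ p) / 2 `^ b.
have C0 : 0 < C by rewrite divr_gt0// mulr_gt0.
have : \forall x \near 0^'+, x `^ (- (p + b)) * G x <= C.
  move/cvgrPdist_le : Gq0 => /(_ _ C0); apply: filterS => x.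
  by rewrite sub0r normrN; exact: le_trans (ler_norm _).
move=> /near_quotient_le_of_weighted; apply: filterS => x /andP[Fx0].
rewrite sub0r normrN ger0_norm// => /le_trans; apply.
rewrite le_eqVlt; apply/orP; left; apply/eqP.
by rewrite /C; field; rewrite !gt_eqF.
Qed.

End tauberian.

(** * Masses of balls in a measure space *)

(** The radius function N stands for the Euclidean norm; its zero set, the
    origin, has measure 0. *)

Section ball_mass.
Context d (T : measurableType d) (R : realType).
Variables (mu : {measure set T -> \bar R}) (N h : T -> R).
Hypotheses (mN : measurable_fun setT N) (N_ge0 : forall x, 0 <= N x).
Hypotheses (mh : measurable_fun setT h) (h_ge0 : forall x, 0 <= h x).
Hypothesis h_fin : (\int[mu]_x (h x)%:E < +oo)%E.
Hypothesis mu0 : mu [set x | N x = 0] = 0%E.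

Let B (r : R) := [set x | N x < r].

(** At b = 0 the weight is 1 everywhere, also where N vanishes, so this includes
    the unweighted mass. *)
Definition ball_mass (b r : R) : \bar R :=
  \int[mu]_(x in B r) (N x `^ b * h x)%:E.

Let mB r : measurable (B r).
Proof.
have -> : B r = N @^-1` `]-oo, r[ by apply/seteqP; split => x; rewrite /= in_itv.
by rewrite -[X in measurable X]setTI; exact: mN.
Qed.

Let mNh b (D : set T) : measurable_fun D (fun x => (N x `^ b * h x)%:E).
Proof.
apply: measurable_funTS; apply/measurable_EFinP; apply: measurable_funM => //.
exact: measurableT_comp (measurable_powR _) mN.
Qed.

Let Nh_ge0 b x : (0 <= (N x `^ b * h x)%:E)%E.
Proof. by rewrite lee_fin mulr_ge0 ?powR_ge0. Qed.

Let massZ b (D : set T) k : measurable D -> 0 <= k ->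
  (\int[mu]_(x in D) (k * (N x `^ b * h x))%:E =
   k%:E * \int[mu]_(x in D) (N x `^ b * h x)%:E)%E.
Proof.
move=> mD k0; under eq_integral do rewrite EFinM.
by rewrite ge0_integralZl// => x _.
Qed.

Let mkNh b k (D : set T) : measurable_fun D (fun x => (k * (N x `^ b * h x))%:E).
Proof.
apply/measurable_EFinP; apply: measurable_funM => //.
by have /measurable_EFinP := @mNh b D.
Qed.

Let shell_ge b (D : set T) a : measurable D -> 0 <= b -> 0 <= a ->
  D `<=` [set x | a <= N x] ->
  ((a `^ b)%:E * \int[mu]_(x in D) (N x `^ 0 * h x)%:E <=
   \int[mu]_(x in D) (N x `^ b * h x)%:E)%E.
Proof.
move=> mD b0 a0 Da; rewrite -massZ ?powR_ge0//; apply: ge0_le_integral => //.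
- by move=> x _; rewrite EFinM mule_ge0// lee_fin powR_ge0.
- by move=> x /Da/= ax; rewrite lee_fin powRr0 mul1r ler_wpM2r//
  ge0_ler_powR// nnegrE.
Qed.

Let shell_le b (D : set T) a : measurable D -> 0 <= b ->
  D `<=` [set x | N x <= a] ->
  (\int[mu]_(x in D) (N x `^ b * h x)%:E <=
   (a `^ b)%:E * \int[mu]_(x in D) (N x `^ 0 * h x)%:E)%E.
Proof.
move=> mD b0 Da; rewrite -massZ ?powR_ge0//; apply: ge0_le_integral => //.
by move=> x /Da/= ax; rewrite lee_fin powRr0 mul1r ler_wpM2r// ge0_ler_powR//
  nnegrE (le_trans (N_ge0 x)).
Qed.

Lemma ball_mass_ge0 b r : (0 <= ball_mass b r)%E.
Proof. exact: integral_ge0. Qed.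

Lemma ball_mass_le b r : 0 <= b ->
  (ball_mass b r <= (r `^ b)%:E * ball_mass 0 r)%E.
Proof. by move=> b0; apply: shell_le => // x /= /ltW. Qed.

Lemma ball_mass_fin b r : 0 <= b -> ball_mass b r \is a fin_num.
Proof.
move=> b0; rewrite ge0_fin_numE ?ball_mass_ge0//.
apply: le_lt_trans (ball_mass_le _ b0) _.
rewrite lte_mul_pinfty ?lee_fin ?powR_ge0//.
apply: le_lt_trans h_fin; rewrite /ball_mass.
under eq_integral do rewrite powRr0 mul1r.
apply: ge0_subset_integral => //; first exact/measurable_EFinP.
by move=> x _; rewrite lee_fin.
Qed.

Lemma ball_mass_shell_comparable b : 0 <= b ->
  shell_comparable b (fine \o ball_mass 0) (fine \o ball_mass b).
Proof.
move=> b0 r s r0 rs /=.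
pose S := B s `\` B r.
have mS : measurable S by exact: measurableD.
have split c : ball_mass c s =
      (ball_mass c r + \int[mu]_(x in S) (N x `^ c * h x)%:E)%E.
  rewrite /ball_mass -ge0_integral_setU//; last by rewrite disj_set2E setDIK.
  by rewrite setDUK// => x /= /lt_le_trans; apply.
have Sfin c : 0 <= c ->
    (\int[mu]_(x in S) (N x `^ c * h x)%:E)%E \is a fin_num.
  move=> c0; have := ball_mass_fin s c0; rewrite split fin_numD => /andP[]//.
have E c : 0 <= c -> fine (ball_mass c s) - fine (ball_mass c r) =
    fine (\int[mu]_(x in S) (N x `^ c * h x)%:E)%E.
  move=> c0; rewrite split fineD ?ball_mass_fin ?Sfin//; lra.
rewrite !E// -!lee_fin !EFinM !fineK ?Sfin//.
apply/andP; split; first apply: shell_ge => //; first exact: ltW.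
- by move=> x [_ /=] /negP; rewrite -leNgt.
- by apply: shell_le => // x [/= /ltW].
Qed.

(** Dominated convergence: the indicators of the balls tend to 0 off the null
    set where N vanishes. *)
Lemma ball_mass0_cvg0 : fine (ball_mass 0 r) @[r --> 0^'+] --> (0 : R).
Proof.
apply/cvg_at_rightP => u [u_gt0 u0].
apply: fine_cvg; rewrite /ball_mass.
under eq_fun do under eq_integral do rewrite powRr0 mul1r.
pose f_ k x := (h x * \1_(B (u k)) x)%:E.
have -> : (fun k => \int[mu]_(x in B (u k)) (h x)%:E)%E =
    (fun k => \int[mu]_x f_ k x)%E.
  apply/funext => k; rewrite integral_mkcond; apply: eq_integral => x _.
  by rewrite /f_ patchE indicE; case: ifPn => _; rewrite ?mulr1 ?mulr0.
have [|||||_ _] := @dominated_convergence _ _ _ mu setT measurableT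
  f_ (cst 0%E) (EFin \o h).
- move=> k; apply/measurable_EFinP; apply: measurable_funM => //.
- exact: measurable_cst.
- exists [set x | N x = 0]; split => //.
    have -> : [set x | N x = 0] = N @^-1` [set 0] by [].
    by rewrite -[X in measurable X]setTI; exact: mN.
  move=> x /= ncv; apply: contrapT => /eqP Nx0; apply: ncv => _.
  have Nx : 0 < N x by rewrite lt_neqAle eq_sym Nx0 N_ge0.
  apply: cvg_near_cst.
  move/cvgrPdist_lt : u0 => /(_ _ Nx); apply: filterS => k.
  rewrite sub0r normrN gtr0_norm// => uk.
  by rewrite /f_ indicE memNset ?mulr0//= => /(lt_trans uk); rewrite ltxx.
- apply/integrableP; split; first exact/measurable_EFinP.
  by under eq_integral do rewrite /= ger0_norm//.
- apply/aeW => x k _; rewrite /f_ /= lee_fin ger0_norm ?mulr_ge0//.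
  by rewrite ler_piMr// indicE lern1 leq_b1.
- by rewrite integral0.
Qed.

Lemma ball_mass_cvg0 b : 0 < b -> fine (ball_mass b r) @[r --> 0^'+] --> (0 : R).
Proof.
move=> b0.
have M0 : r `^ b * fine (ball_mass 0 r) @[r --> 0^'+] --> (0 : R).
  rewrite -[X in _ --> X](mulr0 (0 : R)).
  exact: cvgM (cvg_powR_at_right0 b0) ball_mass0_cvg0.
have le_M r : 0 <= fine (ball_mass b r) <= r `^ b * fine (ball_mass 0 r).
  rewrite fine_ge0 ?ball_mass_ge0//=.
  rewrite -lee_fin EFinM !fineK ?ball_mass_fin ?(ltW b0)//.
  exact: ball_mass_le (ltW b0).
exact: (squeeze_cvgr (nearW _ le_M) (cvg_cst 0) M0).
Qed.

End ball_mass.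

(** * The Fourier side of a Sobolev function *)

Section euclidean.
Context {R : realType}.
Local Notation cnorm := (@ComplexField.Normc.normc R).
Local Notation Re := (@complex.Re R).
Local Notation Im := (@complex.Im R).

Lemma enorm_ge0 n (x : n.-tuple R) : 0 <= enorm x.
Proof. exact: sqrtr_ge0. Qed.

Lemma measurable_enorm n : measurable_fun setT (@enorm R n).
Proof.
apply: measurableT_comp.
  exact: continuous_measurable_fun (@sqrt_continuous R).
apply: measurable_sum => i.
by apply: measurable_funM; exact: measurable_tnth.
Qed.

(** The origin lies in the hyperplane where the first coordinate vanishes, whose
    measure is a product with factor 0. *)
Lemma lebesgue_tuple_origin n : (0 < n)%N ->
  lebesgue_tuple n [set x : n.-tuple R | enorm x = 0] = 0%E.
Proof.
case: n => // n _; apply/eqP; rewrite -measure_le0.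
have m0 : measurable [set x : n.+1.-tuple R | enorm x = 0].
  have -> : [set x : n.+1.-tuple R | enorm x = 0] = @enorm R _ @^-1` [set 0] by [].
  by rewrite -[X in measurable X]setTI; exact: measurable_enorm.
rewrite /= /lebesgue_cons /pushforward.
apply: (@le_trans _ _ (((@lebesgue_measure R) \x lebesgue_tuple n)%E
    ([set 0] `*` setT))); last first.
  rewrite product_measure1E// [X in (X * _)%E](_ : _ = 0%E) ?mul0e//.
  exact: lebesgue_measure_set1.
apply: le_measure; rewrite ?inE.
- rewrite -[X in measurable X]setTI.
  exact: measurable_tuple_cons.
- exact: measurableX.
- move=> [a t] /= /eqP; rewrite /enorm /dotprod sqrtr_eq0 big_ord_recl.
  rewrite !tnth0 /= => le0; split => //=.
  apply/eqP; rewrite -sqrf_eq0 eq_le sqr_ge0 andbT.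
  rewrite (le_trans _ le0)// expr2 lerDl sumr_ge0// => i _.
  by rewrite -expr2 sqr_ge0.
Qed.

Lemma normc_sqr (z : R[i]) : cnorm z ^+ 2 = Re z ^+ 2 + Im z ^+ 2.
Proof. by case: z => a b /=; rewrite sqr_sqrtr// addr_ge0 ?sqr_ge0. Qed.

Lemma L2_integral n (u : n.-tuple R -> R[i]) : L2 u ->
  (\int[lebesgue_tuple n]_x (cnorm (u x) ^+ 2)%:E < +oo)%E.
Proof.
move=> [_ _]; rewrite /L2norm unlock.
have normE x : (`|(cnorm (u x))%:E| `^ 2)%E = (cnorm (u x) ^+ 2)%:E.
  have cn0 : 0 <= cnorm (u x) by case: (u x) => a b; exact: sqrtr_ge0.
  by rewrite /abse ger0_norm// poweR_EFin powR_mulrn.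
under eq_integral do rewrite normE.
set I := (\int[_]_x _)%E => I_fin.
rewrite ltey; apply/eqP => I_oo; move: I_fin.
by rewrite I_oo poweRyr ?ltxx// invr_neq0.
Qed.

Section sobolev.
Variables (n : nat) (s : R) (u : n.-tuple R -> R[i]).
Hypotheses (s_gt0 : 0 < s) (u_Hs : sobolev s u).

Let w (x : n.-tuple R) := (1 + enorm x ^+ 2) `^ (s / 2).

Let w_gt0 x : 0 < w x.
Proof. by rewrite powR_gt0// ltr_wpDr// sqr_ge0. Qed.

Let w_ge1 x : 1 <= w x.
Proof.
rewrite -[leLHS](powRr0 (1 + enorm x ^+ 2)) ler_powR ?lerDl ?sqr_ge0//.
by rewrite divr_ge0// ltW.
Qed.

(* Dividing by w recovers measurability of the Fourier transform from that of
   its weighted version. *)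
Let mwV : measurable_fun setT (fun x => (w x)^-1).
Proof.
under eq_fun do rewrite -powRN.
apply: (measurableT_comp (measurable_powR _)); apply: measurable_funD => //.
by apply: measurable_funX; exact: measurable_enorm.
Qed.

Let Re_fourier x :
  Re (fourier u x) = (w x)^-1 * Re (Complex (w x) 0 * fourier u x).
Proof.
case: (fourier u x) => a b /=; rewrite mul0r subr0 mulrA mulVf ?mul1r//.
by rewrite gt_eqF.
Qed.

Let Im_fourier x :
  Im (fourier u x) = (w x)^-1 * Im (Complex (w x) 0 * fourier u x).
Proof.
case: (fourier u x) => a b /=; rewrite mul0r addr0 mulrA mulVf ?mul1r//.
by rewrite gt_eqF.
Qed.

Lemma sobolev_measurable :
  measurable_fun setT (fun x => cnorm (fourier u x) ^+ 2).
Proof.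
have [_ [mRe mIm _]] := u_Hs.
under eq_fun do rewrite normc_sqr Re_fourier Im_fourier.
by apply: measurable_funD; apply: measurable_funX; apply: measurable_funM.
Qed.

Lemma sobolev_integral :
  (\int[lebesgue_tuple n]_x (cnorm (fourier u x) ^+ 2)%:E < +oo)%E.
Proof.
have [_ L2w] := u_Hs; apply: le_lt_trans (L2_integral L2w).
apply: ge0_le_integral => //.
- by move=> x _; rewrite lee_fin sqr_ge0.
- by apply/measurable_EFinP; exact: sobolev_measurable.
- have [mRe mIm _] := L2w; apply/measurable_EFinP.
  under eq_fun do rewrite normc_sqr.
  by apply: measurable_funD; exact: measurable_funX.
- move=> x _; rewrite lee_fin ComplexField.Normc.normcM exprMn ler_peMl ?sqr_ge0//.
  rewrite normc_sqr /= expr0n addr0 exprn_ege1//; exact: w_ge1.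
Qed.

End sobolev.
End euclidean.

(** * Decay indicators and decay characters *)

Lemma decay_indicatorP (R : realType) n t (u : n.-tuple R -> R[i]) r l :
  decay_quotient t u r rho @[rho --> 0^'+] --> l <->
  decay_indicator_exists t u r /\ decay_indicator t u r = l.
Proof.
split=> [h|[h <-]]; last exact: h.
by split; [exact: cvgP h|exact: cvg_lim h].
Qed.

Section decay.
Context {R : realType}.
Local Notation cnorm := (@ComplexField.Normc.normc R).
Variables (n : nat) (s : R) (u : n.-tuple R -> R[i]).
Hypotheses (n_gt0 : (0 < n)%N) (s_gt0 : 0 < s) (u_Hs : sobolev s u).

(** A real number instead of an extended one: for u in H^s the integral is
    finite, so all decay quotients of order t >= 0 are finite. *)
Definition spectral_mass (t rho : R) : R :=
  fine (ball_mass (lebesgue_tuple n) (@enorm R n)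
    (fun x => cnorm (fourier u x) ^+ 2) (2 * t) rho).

Let cnorm2_ge0 x : 0 <= cnorm (fourier u x) ^+ 2.
Proof. exact: sqr_ge0. Qed.

Let mass_fin t rho : 0 <= t ->
  ball_mass (lebesgue_tuple n) (@enorm R n)
    (fun x => cnorm (fourier u x) ^+ 2) (2 * t) rho \is a fin_num.
Proof.
move=> t0; apply: ball_mass_fin (mulr_ge0 _ t0) => //.
- exact: measurable_enorm.
- exact: enorm_ge0.
- exact: sobolev_measurable u_Hs.
- exact: sobolev_integral u_Hs.
Qed.

Lemma decay_quotientE t r : 0 <= t ->
  decay_quotient t u r =
  fun rho => (rho `^ (- (2 * r + n%:R)) * spectral_mass t rho)%:E.
Proof.
move=> t0; apply/funext => rho.
by rewrite /decay_quotient opprD EFinM /spectral_mass fineK// mass_fin.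
Qed.

Lemma spectral_mass_comparable :
  shell_comparable (2 * s) (spectral_mass 0) (spectral_mass s).
Proof.
rewrite /spectral_mass mulr0; apply: ball_mass_shell_comparable => //.
- exact: measurable_enorm.
- exact: enorm_ge0.
- exact: sobolev_measurable u_Hs.
- exact: sobolev_integral u_Hs.
- by rewrite mulr_ge0 ?ltW.
Qed.

Lemma spectral_mass_cvg0 :
  spectral_mass 0 rho @[rho --> 0^'+] --> (0 : R) /\
  spectral_mass s rho @[rho --> 0^'+] --> (0 : R).
Proof.
have mN := @measurable_enorm R n; have N0 := @enorm_ge0 R n.
have mh := sobolev_measurable u_Hs; have h_fin := sobolev_integral s_gt0 u_Hs.
have mu0 := @lebesgue_tuple_origin R n n_gt0.
rewrite /spectral_mass mulr0; split; first exact: ball_mass0_cvg0.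
by apply: ball_mass_cvg0 => //; rewrite mulr_gt0.
Qed.

Lemma spectral_mass_le rho :
  0 <= spectral_mass s rho <= rho `^ (2 * s) * spectral_mass 0 rho.
Proof.
rewrite fine_ge0 ?ball_mass_ge0//=.
rewrite -lee_fin EFinM !fineK ?mass_fin ?(ltW s_gt0)// mulr0.
apply: ball_mass_le => //.
- exact: measurable_enorm.
- exact: enorm_ge0.
- exact: sobolev_measurable u_Hs.
- by rewrite mulr_ge0 ?ltW.
Qed.

(** Lowering r multiplies the quotient by a positive power of rho; so at most one
    indicator is positive and finite. *)
Lemma decay_indicator_shift (t r r' : R) (P : R) : 0 <= t -> r < r' ->
  decay_quotient t u r' rho @[rho --> 0^'+] --> P%:E ->
  decay_quotient t u r rho @[rho --> 0^'+] --> 0%E.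
Proof.
move=> t0 rr'; rewrite !decay_quotientE// => /fine_cvg /= hP.
apply: cvg_EFin; first exact: nearW.
have e0 : 0 < 2 * (r' - r) by rewrite mulr_gt0// subr_gt0.
have hP0 : rho `^ (2 * (r' - r)) *
    (rho `^ (- (2 * r' + n%:R)) * spectral_mass t rho)
    @[rho --> 0^'+] --> (0 : R).
  rewrite -[X in _ --> X](mul0r P).
  exact: cvgM (cvg_powR_at_right0 e0) hP.
apply: (cvg_trans _ hP0); apply: near_eq_cvg; near=> rho.
have rho0 : 0 < rho by near: rho; exact: nbhs_right_gt.
rewrite /= mulrA -powRD; last by rewrite (gt_eqF rho0) implybT.
by congr (_ `^ _ * _); ring.
Unshelve. all: by end_near. Qed.

Lemma is_decay_character_unique t x y : 0 <= t ->
  is_decay_character t u x -> is_decay_character t u y -> x = y.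
Proof.
have no_two r r' : 0 <= t -> r < r' ->
    decay_indicator_exists t u r -> (0 < decay_indicator t u r)%E ->
    decay_indicator_exists t u r' -> (0 < decay_indicator t u r' < +oo)%E ->
    False.
  move=> t0 rr' er ir er' /andP[ir' iry'].
  have fin : decay_indicator t u r' \is a fin_num.
    by rewrite ge0_fin_numE// ltW.
  have := decay_indicator_shift (P := fine (decay_indicator t u r')) t0 rr'.
  rewrite fineK// => /(_ er') /decay_indicatorP[_ ir0].
  by move: ir; rewrite ir0 ltxx.
move=> t0.
case=> [[r [-> mr er /andP[ir iry]]]|[-> hx]|[-> hx]];
  case=> [[r' [-> mr' er' /andP[ir' iry']]]|[-> hy]|[-> hy]] //.
- case: (ltgtP r r') => [rr'|rr'|-> //]; exfalso.
    by apply: (no_two r r') => //; apply/andP.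
  by apply: (no_two r' r) => //; apply/andP.
- by move: iry; rewrite (hy r mr).2 ltxx.
- by move: ir; rewrite (hy r mr).2 ltxx.
- by move: iry'; rewrite (hx r' mr').2 ltxx.
- have mr : decay_index_min n t < decay_index_min n t + 1 by rewrite ltrDl.
  by have := (hx _ mr).2; rewrite (hy _ mr).2.
- by move: ir'; rewrite (hx r' mr').2 ltxx.
- have mr : decay_index_min n t < decay_index_min n t + 1 by rewrite ltrDl.
  by have := (hx _ mr).2; rewrite (hy _ mr).2.
Qed.

Lemma decay_character_eq t x : 0 <= t ->
  is_decay_character t u x -> decay_character t u = x.
Proof.
move=> t0 hx; apply: xget_unique => // y hy.
exact: is_decay_character_unique hy hx.
Qed.

Lemma decay_characterP t x : decay_character t u = x -> x != -oo%E ->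
  is_decay_character t u x.
Proof.
rewrite /decay_character; case: xgetP => [y -> hy <- //|_ <-].
by rewrite eqxx.
Qed.

End decay.

(** * Orders 0 and s compared *)

Section indicator.
Context {R : realType}.
Variables (n : nat) (s : R) (u : n.-tuple R -> R[i]) (r : R).
Hypotheses (n_gt0 : (0 < n)%N) (s_gt0 : 0 < s) (u_Hs : sobolev s u).
Hypothesis r_gt : - (n%:R / 2) < r.

Let p : R := 2 * r + n%:R.
Let b : R := 2 * s.

Let p_gt0 : 0 < p.
Proof. by rewrite /p; move: r_gt; lra. Qed.

Let b_gt0 : 0 < b.
Proof. by rewrite mulr_gt0. Qed.

Let quotient0E : decay_quotient 0 u r =
  fun rho => (rho `^ (- p) * spectral_mass u 0 rho)%:E.
Proof. exact: (decay_quotientE s_gt0 u_Hs). Qed.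

Let quotientsE : decay_quotient s u (r + s) =
  fun rho => (rho `^ (- (p + b)) * spectral_mass u s rho)%:E.
Proof.
rewrite (decay_quotientE s_gt0 u_Hs) ?ltW//; apply/funext => rho.
by congr (_ `^ (- _) * _)%:E; rewrite /p /b; ring.
Qed.

Let comparable := spectral_mass_comparable s_gt0 u_Hs.
Let mass_le rho (_ : 0 < rho) := spectral_mass_le s_gt0 u_Hs rho.

Lemma decay_indicator_weighted_pos (P : R) : 0 < P ->
  decay_quotient 0 u r rho @[rho --> 0^'+] --> P%:E ->
  decay_quotient s u (r + s) rho @[rho --> 0^'+] --> (P * (p / (p + b)))%:E.
Proof.
rewrite quotient0E quotientsE => P0 /fine_cvg/= hP.
have [_ G0] := spectral_mass_cvg0 n_gt0 s_gt0 u_Hs.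
apply: cvg_EFin; first exact: nearW.
exact: (quotient_cvg_weighted b_gt0 p_gt0 comparable G0 P0 hP).
Qed.

Lemma decay_indicator_eq0 :
  decay_quotient 0 u r rho @[rho --> 0^'+] --> 0%E <->
  decay_quotient s u (r + s) rho @[rho --> 0^'+] --> 0%E.
Proof.
have [F0 _] := spectral_mass_cvg0 n_gt0 s_gt0 u_Hs.
rewrite quotient0E quotientsE; split=> /fine_cvg/= h0;
  (apply: cvg_EFin; first exact: nearW).
  apply: (squeeze_cvgr _ (cvg_cst 0) h0); near=> rho.
  have rho0 : 0 < rho by near: rho; exact: nbhs_right_gt.
  exact: (weighted_quotient_le p mass_le rho0).
exact: (quotient_cvg0_of_weighted p_gt0 comparable F0 mass_le h0).
Unshelve. all: by end_near. Qed.

Lemma decay_indicator_oo_of_weighted :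
  decay_quotient s u (r + s) rho @[rho --> 0^'+] --> +oo%E ->
  decay_quotient 0 u r rho @[rho --> 0^'+] --> +oo%E.
Proof.
rewrite quotient0E quotientsE; apply: gee_cvgy; near=> rho.
have rho0 : 0 < rho by near: rho; exact: nbhs_right_gt.
by rewrite lee_fin; case/andP: (weighted_quotient_le p mass_le rho0).
Unshelve. all: by end_near. Qed.

(** If the limit l of the weighted quotient were smaller than +oo, the weighted
    quotient would be bounded near 0, and so would the unweighted one. *)
Lemma decay_indicator_weighted_oo :
  decay_quotient 0 u r rho @[rho --> 0^'+] --> +oo%E ->
  decay_indicator_exists s u (r + s) ->
  decay_quotient s u (r + s) rho @[rho --> 0^'+] --> +oo%E.
Proof.
rewrite /decay_indicator_exists => F_oo exG.
have /cvg_ex[l Gl] := exG.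
have [<-//|l_oo] := eqVneq l +oo%E; exfalso.
have [C lC] : exists C : R, (l < C%:E)%E.
  case: l l_oo {Gl} => [l _| |_] //; last by exists 0; rewrite ltNyr.
  by exists (l + 1); rewrite lte_fin ltrDl.
have [F0 _] := spectral_mass_cvg0 n_gt0 s_gt0 u_Hs.
have : \forall rho \near 0^'+,
    rho `^ (- (p + b)) * spectral_mass u s rho <= C.
  have : \forall rho \near 0^'+, (decay_quotient s u (r + s) rho < C%:E)%E.
    exact: (Gl _ (open_ereal_lt' lC)).
  by rewrite quotientsE; apply: filterS => rho; rewrite lte_fin => /ltW.
move/(near_quotient_le_of_weighted p_gt0 comparable F0 mass_le) => F_le.
move: F_oo; rewrite quotient0E => /cvgeyPgt /(_ (2 `^ b * C / (1 - 2^-1 `^ p))).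
move=> F_gt.
have both := @filterI _ _ (at_right_proper_filter 0) _ _ F_le F_gt.
have [rho [/andP[_ le] gt]] := filter_ex both.
by move: gt; rewrite lte_fin ltNge le.
Qed.

End indicator.

Theorem theorem2p11 (R : realType) (n : nat) (s : R) (u0 : n.-tuple R -> R[i])
    (n_gt0 : (0 < n)%N) (s_gt0 : 0 < s) (u0_Hs : sobolev s u0) :
  [/\ ((- (n%:R / 2))%:E < decay_character 0 u0 < +oo)%E ->
        ((- (n%:R / 2) + s)%:E < decay_character s u0 < +oo)%E /\
        decay_character s u0 = (s%:E + decay_character 0 u0)%E,
      decay_character s u0 = +oo%E <-> decay_character 0 u0 = +oo%E,
      (forall r : R, - (n%:R / 2) + s < r -> decay_indicator_exists s u0 r) ->
        (decay_character 0 u0 = (- (n%:R / 2))%:E <->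
         decay_character s u0 = (decay_character 0 u0 + s%:E)%E /\
         (decay_character 0 u0 + s%:E)%E = (- (n%:R / 2) + s)%:E)
    & decay_character s u0 = (- (n%:R / 2) + s)%:E ->
        decay_character 0 u0 = (- (n%:R / 2))%:E].
Proof.
pose c : R := - (n%:R / 2).
have min0 : decay_index_min n 0 = c by rewrite /decay_index_min addr0.
have mins : decay_index_min n s = c + s by [].
have s0 : 0 <= s := ltW s_gt0.
have eq0 := decay_character_eq s_gt0 u0_Hs (lexx 0).
have eqs := decay_character_eq s_gt0 u0_Hs s0.
have shift (Q : R -> Prop) : (forall r, c < r -> Q (r + s)) ->
    forall r, c + s < r -> Q r.
  by move=> h r; rewrite -ltrBrDr => /h; rewrite subrK.
have char_min t : decay_character t u0 = (decay_index_min n t)%:E ->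
    forall r, decay_index_min n t < r ->
    decay_quotient t u0 r rho @[rho --> 0^'+] --> +oo%E.
  move=> /decay_characterP -/(_ isT) [[r [[<-]]]|[_ h] r mr|[//]].
    by rewrite ltxx.
  by apply/decay_indicatorP; exact: h.
have char_oo t : decay_character t u0 = +oo%E ->
    forall r, decay_index_min n t < r ->
    decay_quotient t u0 r rho @[rho --> 0^'+] --> 0%E.
  move=> /decay_characterP -/(_ isT) [[r [//]]|[//]|[_ h] r mr].
  by apply/decay_indicatorP; exact: h.
split.
- move=> /andP[gt_c lt_oo].
  have := decay_characterP (erefl (decay_character 0 u0)) _.
  case=> [|[r [-> ]]|[]|[]].
  + by apply/eqP => E; move: gt_c; rewrite E.
  + rewrite min0 => cr er /andP[ir iry].
    have [P EP] : exists P, decay_indicator 0 u0 r = P%:E.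
      by exists (fine (decay_indicator 0 u0 r)); rewrite fineK// ge0_fin_numE// ltW.
    have P0 : 0 < P by rewrite -lte_fin -EP.
    have /decay_indicatorP hP := conj er EP.
    have /decay_indicatorP[es Es] :=
      decay_indicator_weighted_pos n_gt0 s_gt0 u0_Hs cr P0 hP.
    have -> : decay_character s u0 = (r + s)%:E.
      apply: eqs; apply: Or31; exists (r + s); split => //.
        by rewrite mins ltrD2r.
      have p0 : 0 < 2 * r + n%:R by move: cr; rewrite /c; lra.
      by rewrite Es lte_fin ltry andbT mulr_gt0// divr_gt0// addr_gt0// mulr_gt0.
    by rewrite lte_fin ltrD2r cr ltry -EFinD addrC.
  + by move=> E; move: gt_c; rewrite E min0 ltxx.
  + by move=> E; move: lt_oo; rewrite E ltxx.
- split=> /char_oo h; [apply: eq0|apply: eqs]; apply: Or33; split => // r.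
  + rewrite min0 => cr; apply/decay_indicatorP.
    apply/(decay_indicator_eq0 n_gt0 s_gt0 u0_Hs cr).
    by apply: h; rewrite mins ltrD2r.
  + move: r; rewrite mins; apply: shift => r cr; apply/decay_indicatorP.
    apply/(decay_indicator_eq0 n_gt0 s_gt0 u0_Hs cr).
    by apply: h; rewrite min0.
- move=> exs; split=> [E0|[_]].
  + rewrite E0; split => //; apply: eqs; apply: Or32; split => // r.
    move: r; rewrite mins; apply: shift => r cr; apply/decay_indicatorP.
    apply: (decay_indicator_weighted_oo n_gt0 s_gt0 u0_Hs cr).
      by apply: char_min; rewrite min0.
    by apply: exs; rewrite ltrD2r.
  + by case: (decay_character 0 u0) => //= x [] /addIr ->.
- move=> Es; apply: eq0; apply: Or32; split; first by rewrite min0.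
  move=> r; rewrite min0 => cr; apply/decay_indicatorP.
  apply: (decay_indicator_oo_of_weighted s_gt0 u0_Hs).
  by apply: char_min => //; rewrite mins ltrD2r.
Qed.
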